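(* Let $k\ge 2$ and let $G$ be a doubly-perfect $k$-uniform hypergraph. If $G$ is neither complete nor empty, then $k\le 3$. Moreover, if $k=3$, then $G$ is a cocycle, i.e. every 4 vertices of $G$ span an even number of edges.
   Context: All hypergraphs are finite. A $k$-uniform hypergraph $G$ has a vertex set $V(G)$ and an edge set $E(G)$ consisting of $k$-element subsets of $V(G)$; it is complete if all $k$-subsets of $V(G)$ are edges (vacuously so if there are fewer than $k$ vertices), and empty if it has no edges. The complement $G^c$ has vertex set $V(G)$ and its edges are the $k$-subsets of $V(G)$ that are not edges of $G$. For $W\subseteq V(G)$, $G[W]$ is the induced subhypergraph on $W$, and $\omega(G)$ is the maximum size of $W\subseteq V(G)$ such that $G[W]$ is complete. For $X\subseteq V(G)$ with $|X|<k$, the link $lk_G(X)$ is the $(k-|X|)$-uniform hypergraph with vertex set $V(G)\setminus X$ in which $Y$ is an edge iff $X\cup Y\in E(G)$. A proper $s$-coloring of a $k$-uniform hypergraph $G$ is a coloring of the $(k-1)$-element subsets of $V(G)$ with $s$ colors such that for no edge $F$ of $G$ do all the $(k-1)$-subsets of $F$ receive the same color. For $X\subseteq V(G)$ with $|X|<k-1$, a coloring $c$ of the $(k-1)$-subsets of $V(G)$ restricts to the coloring $Z\mapsto c(X\cup Z)$ of the $(k-1-|X|)$-subsets $Z$ of $V(G)\setminus X=V(lk_G(X))$. $G$ is $C_\omega$-perfect if for every induced subhypergraph $G'$ of $G$ and every $X\subseteq V(G')$ with $|X|<k-1$, there is a proper $(\omega(G')-k+2)$-coloring of $G'$ that restricts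 to a proper $(\omega(G')-k+2)$-coloring of $lk_{G'}(X)$. (If $|V(G')|<k-1$ there are no $(k-1)$-subsets to color and the condition is regarded as satisfied.) $G$ is doubly perfect if both $G$ and $G^c$ are $C_\omega$-perfect. *)

(* Defs.v *)
From mathcomp Require Import all_boot.

Set Implicit Arguments.
Unset Strict Implicit.
Unset Printing Implicit Defensive.

Definition ksubsets (T : finType) (k : nat) (V : {set T}) : {set {set T}} :=
  [set S : {set T} | (S \subset V) && (#|S| == k)].

(* The vertex set is a subset of an ambient finite type, so that induced
   subhypergraphs and links are again hypergraphs over the same type. *)
Record hypergraph (T : finType) (k : nat) := Hypergraph {
  vset : {set T};
  eset : {set {set T}};
  esetP : eset \subset ksubsets k vset
}.

Section Hypergraphs.
Context {T : finType}.
Implicit Types (k s : nat) (S W X Y Z F : {set T}).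

Definition complete k (G : hypergraph T k) : bool :=
  eset G == ksubsets k (vset G).

Definition empty k (G : hypergraph T k) : bool := eset G == set0.

Lemma compl_subproof k (G : hypergraph T k) :
  ksubsets k (vset G) :\: eset G \subset ksubsets k (vset G).
Proof. exact: subsetDl. Qed.

Definition compl k (G : hypergraph T k) : hypergraph T k :=
  Hypergraph (compl_subproof G).

Lemma induced_subproof k (G : hypergraph T k) W :
  [set F in eset G | F \subset W] \subset ksubsets k W.
Proof.
apply/subsetP=> F; rewrite inE => /andP[FG FW].
by have := subsetP (esetP G) F FG; rewrite !inE FW => /andP[].
Qed.

(* Only meant for W \subset vset G. *)
Definition induced k (G : hypergraph T k) W : hypergraph T k :=
  Hypergraph (induced_subproof G W).

Definition omega k (G : hypergraph T k) : nat :=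
  \max_(W : {set T} | (W \subset vset G) && complete (induced G W)) #|W|.

Lemma link_subproof k (G : hypergraph T k) X :
  [set Y : {set T} | (Y \subset vset G :\: X) && (X :|: Y \in eset G)]
    \subset ksubsets (k - #|X|) (vset G :\: X).
Proof.
apply/subsetP=> Y; rewrite !inE => /andP[YV XYG]; rewrite YV /=.
have := subsetP (esetP G) _ XYG; rewrite inE => /andP[_ /eqP <-].
have /eqP XY0 : X :&: Y == set0.
  by rewrite setI_eq0 disjoint_sym; move: YV; rewrite subsetD => /andP[].
by rewrite cardsU XY0 cards0 subn0 addKn.
Qed.

(* Only meant for X \subset vset G with #|X| < k. *)
Definition link k (G : hypergraph T k) X : hypergraph T (k - #|X|) :=
  Hypergraph (link_subproof G X).

(* The s colors are 0, ..., s - 1, and only the values of c on the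
   (k-1)-subsets of the vertex set matter. Hence if there are no such subsets
   then a 0-coloring exists. *)
Definition proper_coloring k s (G : hypergraph T k) (c : {set T} -> nat) : Prop :=
  (forall Z, Z \in ksubsets (k - 1) (vset G) -> c Z < s) /\
  (forall F, F \in eset G ->
     ~ (forall Z1 Z2, Z1 \in ksubsets (k - 1) F -> Z2 \in ksubsets (k - 1) F ->
          c Z1 = c Z2)).

(* The truncated omega H + 2 - k is the true omega(H) - k + 2 as soon as
   #|W| >= k - 2; otherwise there is nothing to color, in H or in its link,
   and the condition holds trivially. *)
Definition Comega_perfect k (G : hypergraph T k) : Prop :=
  forall W X, W \subset vset G -> X \subset W -> #|X| < k - 1 ->
    let H := induced G W in
    let s := omega H + 2 - k in
    exists c : {set T} -> nat,
      proper_coloring s H c /\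
      proper_coloring s (link H X) (fun Z => c (X :|: Z)).

Definition doubly_perfect k (G : hypergraph T k) : Prop :=
  Comega_perfect G /\ Comega_perfect (compl G).

Definition cocycle k (G : hypergraph T k) : Prop :=
  forall S, S \in ksubsets 4 (vset G) -> ~~ odd #|eset (induced G S)|.

End Hypergraphs.

(* Main.v *)
Require Import Defs.
From mathcomp Require Import all_boot.

Set Implicit Arguments.
Unset Strict Implicit.
Unset Printing Implicit Defensive.

(** Everything happens on [k + 1] vertices.  Let [W] be a set of [k + 1]
    vertices and let [M] be the set of those [w] in [W] for which [W :\ w] is an
    edge, so that [M] encodes the subhypergraph induced on [W].

    If [G] is C_omega-perfect and [M] has three elements, then [M = W]
    ([edge_apexes_full]).  Otherwise [W] is not complete, so at most two colors
    are allowed on it; but the link of the [k - 2] vertices of [W] other than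
    the three elements of [M] is a triangle, which needs three colors.

    If [G] is doubly perfect then the same holds for [W :\: M], which encodes
    the complement.  So if [M] is neither empty nor [W], then [M] and [W :\: M]
    both have at most two elements, and [k + 1 <= 4].  If [k = 3] this leaves
    [#|M|] equal to 0, 2 or 4, which is the cocycle condition.  If [k >= 4],
    every [k + 1] vertices span all or none of the possible edges, and since one
    can go from any [k]-set of vertices to any other by exchanging one vertex
    at a time, [G] itself is complete or empty ([edge_exchange_closed]). *)

Section FacetsOfASimplex.
Context {T : finType}.
Implicit Types (k : nat) (W F : {set T}).

Definition edge_apexes k (G : hypergraph T k) W : {set T} :=
  [set w in W | W :\ w \in eset G].

Lemma edge_apexes_sub k (G : hypergraph T k) W : edge_apexes G W \subset W.
Proof. by apply/subsetP=> w; rewrite inE => /andP[]. Qed.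

Lemma facet_ksubset k (V W : {set T}) w :
  W \subset V -> #|W| = k.+1 -> w \in W -> W :\ w \in ksubsets k V.
Proof.
move=> WV cW wW; rewrite inE (subset_trans (subD1set _ _) WV) /=.
by rewrite -eqSS -cW (cardsD1 w W) wW.
Qed.

Lemma ksubset_facet k W F :
  #|W| = k.+1 -> F \subset W -> #|F| = k -> exists2 w, w \in W & F = W :\ w.
Proof.
move=> cW FW cF; have /cards1P[w Dw] : #|W :\: F| == 1.
  by rewrite cardsD (setIidPr FW) cW cF subSnn.
exists w; first by have := set11 w; rewrite -Dw inE => /andP[].
by rewrite -Dw setDDr setDv set0U (setIidPr FW).
Qed.

Lemma edge_apexes_compl k (G : hypergraph T k) W :
    W \subset vset G -> #|W| = k.+1 ->
  edge_apexes (compl G) W = W :\: edge_apexes G W.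
Proof.
move=> WV cW; apply/setP=> w; rewrite !inE.
case: (boolP (w \in W)) => wW; rewrite ?andbF //= andbT.
by have := facet_ksubset WV cW wW; rewrite inE => ->; rewrite andbT.
Qed.

Lemma card_eset_induced k (G : hypergraph T k) W :
  #|W| = k.+1 -> #|eset (induced G W)| = #|edge_apexes G W|.
Proof.
move=> cW; have -> : eset (induced G W) = [set W :\ w | w in edge_apexes G W].
  apply/setP=> F; rewrite inE; apply/andP/imsetP => [[FG FW]|[w + ->]].
    have := subsetP (esetP G) F FG; rewrite inE => /andP[_ /eqP cF].
    have [w wW DF] := ksubset_facet cW FW cF.
    by exists w; rewrite // inE wW -DF.
  by rewrite inE => /andP[_ ->]; rewrite subD1set.
apply: card_in_imset => x y; rewrite !inE => /andP[xW _] /andP[yW _] Exy.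
have := setD11 x W; rewrite Exy !inE xW andbT => /negbFE/eqP //.
Qed.

(** A complete subset with more than [k] vertices would have to be [W]. *)
Lemma omega_le_uniformity k (G : hypergraph T k) W :
  #|W| = k.+1 -> edge_apexes G W != W -> omega (induced G W) <= k.
Proof.
move=> cW nMW; apply/bigmax_leqP=> U /andP[/= UW compU].
rewrite leqNgt; apply: contra nMW => cU.
have EU : U = W by apply/eqP; rewrite eqEcard UW cW.
rewrite eqEsubset edge_apexes_sub; apply/subsetP=> w wW; rewrite inE wW /=.
have := facet_ksubset (subxx W) cW wW.
by move: compU; rewrite EU => /eqP/= <-; rewrite !inE => /andP[/andP[]].
Qed.

End FacetsOfASimplex.

Section DoublyPerfect.
Context {T : finType}.
Implicit Types (k s : nat) (W S A B : {set T}).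

(** Removing the third element of [S] from [W] leaves an edge of [G], so any two
    elements of [S] are adjacent in the link of [W :\: S], which is therefore
    a triangle. *)
Lemma link_coloring_inj k s (G : hypergraph T k) W S (c : {set T} -> nat) :
    2 <= k -> #|W| = k.+1 -> S \subset edge_apexes G W -> #|S| = 3 ->
    proper_coloring s (link (induced G W) (W :\: S)) c ->
  {in S &, injective (fun u => c [set u])}.
Proof.
move=> k2 cW SM cS [_ propc] x y xS yS Exy; apply/eqP/negPn/negP => xy.
have SW := subset_trans SM (edge_apexes_sub G W).
have cX : #|W :\: S| = k - 2 by rewrite cardsD (setIidPr SW) cW cS subSS.
have /cards1P[z Dz] : #|S :\: [set x; y]| == 1.
  by rewrite cardsD (setIidPr _) ?cS ?cards2 ?xy // subUset !sub1set xS.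
have /andP[zxy zS] : (z \notin [set x; y]) && (z \in S).
  by rewrite -in_setD Dz set11.
have DS : S = [set z; x; y].
  rewrite -setUA -Dz setUC setDE setUIr setUCr setIT (setUidPr _) //.
  by rewrite subUset !sub1set xS.
have DWz : W :\: S :|: [set x; y] = W :\ z.
  apply/setP=> u; have := subsetP SW u; rewrite DS !inE in zxy *.
  case: (eqVneq u z) => [->|_ /=]; first by rewrite (negPf zxy).
  by case: (_ || _) => [-> //|_]; rewrite /= orbF.
have ez : W :\ z \in eset G by have := subsetP SM z zS; rewrite inE => /andP[].
apply: (propc [set x; y]) => [|Z1 Z2].
  rewrite !inE DWz ez subD1set /= andbT subUset !sub1set !inE xS yS /=.
  by rewrite !(subsetP SW).
(* [k - #|W :\: S| - 1 = 1]: the colored subsets of an edge are its two ends. *)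
rewrite cX subKn // !inE => /andP[+ /cards1P[u Du]] /andP[+ /cards1P[v Dv]].
by rewrite Du Dv !sub1set !inE => /orP[]/eqP-> /orP[]/eqP->.
Qed.

(** Otherwise the number of colors is at most two, by [omega_le_uniformity], but
    a triangle has no proper 2-coloring. *)
Lemma edge_apexes_full k (G : hypergraph T k) W :
    2 <= k -> Comega_perfect G -> W \subset vset G -> #|W| = k.+1 ->
  2 < #|edge_apexes G W| -> edge_apexes G W = W.
Proof.
move=> k2 pG WV cW /card_geqP[t [Ut st tM]].
pose S : {set T} := [set u in t].
have cS : #|S| = 3 by rewrite cardsE (card_uniqP Ut).
have SM : S \subset edge_apexes G W by apply/subsetP=> u; rewrite inE => /tM.
have SW := subset_trans SM (edge_apexes_sub G W).
have cX : #|W :\: S| = k - 2 by rewrite cardsD (setIidPr SW) cW cS subSS.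
apply/eqP/negPn/negP => nMW.
have ltX : #|W :\: S| < k - 1 by rewrite cX ltn_sub2l.
have [c [_ linkc]] := pG W (W :\: S) WV (subsetDl _ _) ltX.
have s2 : omega (induced G W) + 2 - k <= 2.
  by rewrite leq_subLR leq_add2r omega_le_uniformity.
have lt2 u : u \in S -> c (W :\: S :|: [set u]) < 2.
  move=> uS; apply: leq_trans s2; apply: linkc.1.
  by rewrite inE /= cards1 cX subKn // sub1set !in_setD uS (subsetP SW).
have injc := link_coloring_inj k2 cW SM cS linkc.
have : #|S| <= #|'I_2|.
  apply: (@leq_card_in _ _ (fun u => inord (c (W :\: S :|: [set u])))) => x y xS yS.
  by move/(congr1 (@nat_of_ord 2)); rewrite !inordK ?lt2 //; exact: injc.
by rewrite cS card_ord.
Qed.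

Lemma doubly_perfect_apexes k (G : hypergraph T k) W :
    2 <= k -> doubly_perfect G -> W \subset vset G -> #|W| = k.+1 ->
  [\/ edge_apexes G W = W, edge_apexes G W = set0 |
      #|edge_apexes G W| <= 2 /\ #|W :\: edge_apexes G W| <= 2].
Proof.
move=> k2 [pG pGc] WV cW.
have full := edge_apexes_full k2 pG WV cW.
have := edge_apexes_full k2 pGc WV cW.
rewrite edge_apexes_compl // => fullc.
case: (leqP #|edge_apexes G W| 2) => [le2|/full ?]; last by constructor 1.
case: (leqP #|W :\: edge_apexes G W| 2) => [?|/fullc DM].
  by constructor 3.
constructor 2; rewrite -(setIidPr (edge_apexes_sub G W)).
by apply/eqP; rewrite setI_eq0; apply/setDidPl.
Qed.

(** Induction on [#|A :\: B|]: exchanging an element of [A :\: B] for one of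
    [B :\: A] stays inside a set of [k + 1] vertices. *)
Lemma edge_exchange_closed k (G : hypergraph T k) A B :
    (forall W, W \subset vset G -> #|W| = k.+1 ->
       edge_apexes G W = W \/ edge_apexes G W = set0) ->
  A \in eset G -> B \in ksubsets k (vset G) -> B \in eset G.
Proof.
move=> homG; move En: #|A :\: B| => n.
elim: n A En => [|n IHn] A En AG BV.
all: have := BV; have := subsetP (esetP G) A AG; rewrite !inE.
all: move=> /andP[sAV /eqP cA] /andP[sBV /eqP cB].
  move/cards0_eq/eqP: En; rewrite setD_eq0 => sAB.
  have <- // : A = B by apply/eqP; rewrite eqEcard sAB cA cB leqnn.
have /card_gt0P[a aAB] : 0 < #|A :\: B| by rewrite En.
have /card_gt0P[b bBA] : 0 < #|B :\: A|.
  by rewrite cardsD cB setIC -cA -cardsD En.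
move: aAB bBA; rewrite !inE => /andP[aB aA] /andP[bA bB].
pose W := b |: A.
have cW : #|W| = k.+1 by rewrite cardsU1 bA cA.
have sWV : W \subset vset G by rewrite subUset sub1set (subsetP sBV).
have DWb : W :\ b = A by rewrite setU1K.
have bM : b \in edge_apexes G W by rewrite inE DWb AG setU11.
have aM : a \in edge_apexes G W.
  case: (homG W sWV cW) => DM; last by rewrite DM inE in bM.
  by rewrite DM !inE aA orbT.
apply: (IHn (W :\ a)) => //; last by move: aM; rewrite inE => /andP[].
have -> : W :\ a :\: B = (A :\: B) :\ a.
  apply/setP=> u; rewrite !inE; case: (eqVneq u b) => [->|_ /=].
    by rewrite bB !andbF.
  by rewrite andbCA.
by apply/eqP; rewrite -eqSS -En (cardsD1 a (A :\: B)) !inE aB aA.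
Qed.

End DoublyPerfect.

Theorem mainTheorem9 (T : finType) (k : nat) (G : hypergraph T k)
  (hk : 2 <= k) (hG : doubly_perfect G) :
  (~~ complete G -> ~~ empty G -> k <= 3) /\ (k = 3 -> cocycle G).
Proof.
split=> [ncG neG | k3 W]; last first.
  rewrite inE => /andP[WV /eqP cW4].
  have cW : #|W| = k.+1 by rewrite k3.
  rewrite (card_eset_induced G cW).
  case: (doubly_perfect_apexes hk hG WV cW) => [->|->|]; rewrite ?cW4 ?cards0 //.
  rewrite cardsD (setIidPr (edge_apexes_sub G W)) cW4.
  by case: #|_| => [|[|[|n]]] [].
rewrite leqNgt; apply/negP=> k4.
have homG (W : {set T}) : W \subset vset G -> #|W| = k.+1 ->
    edge_apexes G W = W \/ edge_apexes G W = set0.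
  move=> WV cW; case: (doubly_perfect_apexes hk hG WV cW) => [||[le2 le2c]].
  - by left.
  - by right.
  have := leq_add le2 le2c.
  rewrite cardsD (setIidPr (edge_apexes_sub G W)) subnKC ?cW.
    by rewrite leqNgt ltnS k4.
  by rewrite -cW subset_leq_card ?edge_apexes_sub.
have [A AG] := set0Pn _ neG.
move/negP: ncG; apply; rewrite /complete eqEsubset esetP.
by apply/subsetP=> B; apply: edge_exchange_closed AG.
Qed.
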